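(* Let $n,m\ge 1$ and let $f_i:\mathbb{R}^n\to\mathbb{R}$, $f_i(x)=\tfrac12 (x-c_i)^\top H_i (x-c_i)+v_i$ for $i=1,\dots,m$, where $c_i\in\mathbb{R}^n$ with $c_i\neq c_j$ for $i\neq j$, $v_i\in\mathbb{R}$, and each $H_i\in\mathbb{R}^{n\times n}$ is symmetric positive definite. Let $f=(f_1,\dots,f_m)$. Let $g_1,\dots,g_p:\mathbb{R}^n\to\mathbb{R}$ ($p\ge 0$) be convex and lower semicontinuous, let $h_1,\dots,h_q:\mathbb{R}^n\to\mathbb{R}$ ($q\ge 0$) be linear, and let $C=\{x\in\mathbb{R}^n : g_i(x)\le 0,\ i=1,\dots,p,\ h_j(x)=0,\ j=1,\dots,q\}$ be the associated feasible set. Assume that $C$ is non-empty. For $\theta\in\mathcal{S}^m$ let $H_\theta=\sum_{i=1}^m\theta_iH_i$ and $c_\theta=H_\theta^{-1}\big(\sum_{i=1}^m\theta_iH_ic_i\big)$. Then $x^\star$ is Pareto-optimal for the problem $(f,C)$ if and only if, for some $\theta\in\mathcal{S}^m$, it is the projection onto $C$, with respect to the norm $\|\cdot\|_{H_\theta}$, of the point $c_\theta$ of the unconstrained Pareto set $\mathrm{PS}^{(f,\mathbb{R}^n)}$. In other words, $$\mathrm{PS}^{(f,C)}=\Big\{\mathrm{Proj}_{C,\|\cdot\|_{H_\theta}}(c_\theta)\ :\ c_\theta=\Big(\sum_{i=1}^m\theta_iH_i\Big)^{-1}\sum_{i=1}^m\theta_iH_ic_i,\ \theta\in\mathcal{S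}^m\Big\}.$$
   Context: $\mathcal{S}^m=\{\theta\in\mathbb{R}^m : \theta_i\ge 0,\ \sum_i\theta_i=1\}$ is the unit simplex. A ''linear'' constraint function is one of the form $x\mapsto a^\top x+b$ with $a\in\mathbb{R}^n$, $b\in\mathbb{R}$. For a function $f=(f_1,\dots,f_m):\mathbb{R}^n\to\mathbb{R}^m$ (to be minimized), $y$ dominates $x$, written $y\prec x$, if $f_i(y)\le f_i(x)$ for all $i$ and $f_j(y)<f_j(x)$ for some $j$. For $C\subset\mathbb{R}^n$, a point $x$ is Pareto-optimal for the problem $(f,C)$ if $x\in C$ and there is no $y\in C$ with $y\prec x$. The Pareto set $\mathrm{PS}^{(f,C)}$ is the set of all Pareto-optimal points of $(f,C)$; $\mathrm{PS}^{(f,\mathbb{R}^n)}$ is the unconstrained Pareto set. For $A$ symmetric positive definite, $\|x\|_A=\sqrt{x^\top A x}$. For a non-empty closed convex set $C\subset\mathbb{R}^n$ and a norm $\|\cdot\|$ deriving from an inner product, $\mathrm{Proj}_{C,\|\cdot\|}(x)$ is the unique $y\in C$ with $\|x-y\|=\inf_{z\in C}\|x-z\|$. *)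

(* Defs.v *)
From HB Require Import structures.
From mathcomp Require Import all_boot all_order all_algebra.
From mathcomp Require Import all_classical all_reals all_analysis.

Set Implicit Arguments.
Unset Strict Implicit.
Unset Printing Implicit Defensive.

Import Order.TTheory GRing.Theory Num.Theory.
Import numFieldNormedType.Exports.

Local Open Scope classical_set_scope.
Local Open Scope ring_scope.

Section pareto.
Context {R : realType} {n m : nat}.
Implicit Types (f : 'cV[R]_n -> 'cV[R]_m) (C : set 'cV[R]_n) (x y : 'cV[R]_n).

Definition dominates f y x : Prop :=
  (forall i, f y i 0 <= f x i 0) /\ (exists j, f y j 0 < f x j 0).

Definition pareto_set f C : set 'cV[R]_n :=
  [set x | C x /\ ~ (exists2 y, C y & dominates f y x)].

End pareto.

Section quadratic.
Context {R : realType} {n : nat}.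
Implicit Types (A : 'M[R]_n) (x c : 'cV[R]_n) (v : R).

Definition qform A x : R := (x^T *m A *m x) 0 0.

Definition sym_posdef A : Prop :=
  A^T = A /\ (forall x, x != 0 -> 0 < qform A x).

Definition mxnorm A x : R := Num.sqrt (qform A x).

Definition quadratic A c v x : R := 2^-1 * qform A (x - c) + v.

End quadratic.

Section projection.
Context {R : realType} {n : nat}.
Implicit Types (C : set 'cV[R]_n) (N : 'cV[R]_n -> R) (x y : 'cV[R]_n).

Definition is_projection C N x y : Prop :=
  unique (fun y' => C y' /\ N (x - y') = inf [set N (x - z) | z in C]) y.

(* 0 is a junk value, used when there is no unique nearest
   point. *)
Definition projection C N x : 'cV[R]_n := xget 0 (is_projection C N x).

End projection.

Section constraints.
Context {R : realType} {n : nat}.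

Definition linear_constraint (h : 'cV[R]_n -> R) : Prop :=
  exists (a : 'cV[R]_n) (b : R), forall x, h x = (a^T *m x) 0 0 + b.

Definition feasible_set {p q : nat} (g : 'I_p -> 'cV[R]_n -> R)
    (h : 'I_q -> 'cV[R]_n -> R) : set 'cV[R]_n :=
  [set x | (forall i, g i x <= 0) /\ (forall j, h j x = 0)].

End constraints.

Section weights.
Context {R : realType} {n m : nat}.
Implicit Types (H : 'I_m -> 'M[R]_n) (c : 'I_m -> 'cV[R]_n) (theta : 'cV[R]_m).

Definition unit_simplex : set 'cV[R]_m :=
  [set theta | (forall i, 0 <= theta i 0) /\ \sum_i theta i 0 = 1].

Definition Htheta H theta : 'M[R]_n := \sum_i theta i 0 *: H i.

Definition ctheta H c theta : 'cV[R]_n :=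
  invmx (Htheta H theta) *m \sum_i theta i 0 *: (H i *m c i).

End weights.

(* Main.v *)
(* Minimising a convex combination of the f_i over C is the same as minimising the
   distance to c_theta for the norm of H_theta, because the combination is a
   quadratic with Hessian H_theta and minimiser c_theta.  So the claim is that
   the Pareto-optimal points are the minimisers of such scalarizations.  If x is
   Pareto-optimal, no y in C makes all the convex functions f_i - f_i x negative,
   and the weights come from the theorem of the alternative for convex functions,
   which is proved by induction on their number: restrict the remaining functions
   to the convex set where the first one is negative, and combine their
   weighted sum with the first function by the case of two functions. *)
Require Import Defs.
From HB Require Import structures.
From mathcomp Require Import all_boot all_order all_algebra.
From mathcomp Require Import all_classical all_reals all_analysis.
From mathcomp Require Import ring lra.

Set Implicit Arguments.
Unset Strict Implicit.
Unset Printing Implicit Defensive.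

Import Order.TTheory GRing.Theory Num.Theory.
Import numFieldNormedType.Exports.

Local Open Scope classical_set_scope.
Local Open Scope ring_scope.

(** * Convexity and the theorem of the alternative *)

Section convexity.
Context {R : realType} {E : lmodType R}.
Implicit Types (S : set E) (F G : E -> R).

Lemma convex_setP S : convex_set S <->
  (forall x y t, 0 <= t -> t <= 1 -> S x -> S y -> S (t *: x + (1 - t) *: y)).
Proof.
split=> [cS x y t t0 t1 Sx Sy|cS x y t /set_mem Sx /set_mem Sy].
  by have /set_mem := cS x y (Itv01 t0 t1) (mem_set Sx) (mem_set Sy).
by apply/mem_set; apply: cS.
Qed.

Lemma convex_functionP S F : convex_function S F <->
  (forall x y t, 0 <= t -> t <= 1 -> S x -> S y ->
     F (t *: x + (1 - t) *: y) <= t * F x + (1 - t) * F y).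
Proof.
split=> [cF x y t t0 t1 Sx Sy|cF t x y /set_mem Sx /set_mem Sy].
  exact: (cF (Itv01 t0 t1) x y (mem_set Sx) (mem_set Sy)).
exact: cF.
Qed.

Lemma convex_functionS S S' F :
  S `<=` S' -> convex_function S' F -> convex_function S F.
Proof.
move=> sub /convex_functionP cF; apply/convex_functionP => x y t t0 t1 Sx Sy.
by apply: cF => //; apply: sub.
Qed.

Lemma convex_function_sum m S (F : 'I_m -> E -> R) (w : 'I_m -> R) :
  (forall i, 0 <= w i) -> (forall i, convex_function S (F i)) ->
  convex_function S (fun x => \sum_i w i * F i x).
Proof.
move=> w0 cF; apply/convex_functionP => x y t t0 t1 Sx Sy.
rewrite !mulr_sumr -big_split /=; apply: ler_sum => i _.
have /convex_functionP/(_ x y t t0 t1 Sx Sy) := cF i.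
move=> /(ler_wpM2l (w0 i))/le_trans; apply.
by rewrite le_eqVlt; apply/orP; left; apply/eqP; ring.
Qed.

Lemma convex_sublevel S F : convex_set S -> convex_function S F ->
  convex_set (S `&` [set x | F x < 0]).
Proof.
move=> /convex_setP cS /convex_functionP cF; apply/convex_setP.
move=> x y t t0 t1 [Sx /= Fx] [Sy /= Fy]; split; first exact: cS.
rewrite /=; apply: le_lt_trans (cF _ _ _ t0 t1 Sx Sy) _.
(* For [t] positive, strictness comes from [F x < 0]; at [t = 0] it has to come from [F y < 0]. *)
have [->|tn0] := eqVneq t 0; first by rewrite mul0r add0r subr0 mul1r.
have tgt0 : 0 < t by rewrite lt_def tn0.
nra.
Qed.

(** Each point with [G] negative imposes a lower bound on [t], and each point with [F] negative an
    upper bound. The supremum of the lower bounds works once every lower bound is at most every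
    upper bound. *)
Lemma convex_alternative2 S F G :
  convex_set S -> convex_function S F -> convex_function S G ->
  (forall x, S x -> 0 <= F x \/ 0 <= G x) ->
  exists t, [/\ 0 <= t, t <= 1 &
    forall x, S x -> 0 <= t * F x + (1 - t) * G x].
Proof.
move=> /convex_setP cS /convex_functionP cF /convex_functionP cG FG.
(* Where [G x < 0], hence [0 <= F x], the inequality sought reads [l x <= t]. *)
pose l x := - G x / (F x - G x).
(* This is [l a <= G b / (G b - F b)] with denominators cleared. If it failed, some convex
   combination of [a] and [b] would make both functions negative. *)
have cross a b : S a -> S b -> G a < 0 -> F b < 0 -> G a * F b <= G b * F a.
  move=> Sa Sb Ga Fb; rewrite leNgt; apply/negP => lt.
  have Fa : 0 <= F a by case: (FG a Sa) => // /(lt_le_trans Ga); rewrite ltxx.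
  have Gb : 0 <= G b by case: (FG b Sb) => // /(lt_le_trans Fb); rewrite ltxx.
  (* The weights make F and G both bounded by the same negative determinant. *)
  pose d := (G b - F b) + (F a - G a).
  have d0 : 0 < d by rewrite /d; lra.
  pose t := (G b - F b) / d.
  have t0 : 0 <= t by apply: divr_ge0; rewrite /d; lra.
  have t1 : t <= 1 by rewrite ler_pdivrMr // mul1r /d; lra.
  have tE : 1 - t = (F a - G a) / d by rewrite /t /d; field; rewrite gt_eqF.
  have neg : (G b * F a - G a * F b) / d < 0.
    by rewrite pmulr_llt0 ?invr_gt0 // subr_lt0.
  have Fc : F (t *: a + (1 - t) *: b) < 0.
    apply: le_lt_trans (cF _ _ _ t0 t1 Sa Sb) _.
    by rewrite tE /t (_ : _ + _ = (G b * F a - G a * F b) / d) //; ring.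
  have Gc : G (t *: a + (1 - t) *: b) < 0.
    apply: le_lt_trans (cG _ _ _ t0 t1 Sa Sb) _.
    by rewrite tE /t (_ : _ + _ = (G b * F a - G a * F b) / d) //; ring.
  by case: (FG _ (cS _ _ _ t0 t1 Sa Sb)); rewrite leNgt ?Fc ?Gc.
(* Adding 0 makes the supremum nonnegative, and defined even if [G] is never negative. *)
pose L := [set 0] `|` [set l a | a in S `&` [set a | G a < 0]].
have L1 : ubound L 1.
  move=> _ [->|[a [Sa /= Ga] <-]] //.
  have Fa : 0 <= F a by case: (FG a Sa) => // /(lt_le_trans Ga); rewrite ltxx.
  by rewrite /l ler_pdivrMr; lra.
have L0 : L 0 by left.
have Lsup : has_sup L by split; [exists 0|exists 1].
exists (sup L); split.
- by apply: ub_le_sup => //; exists 1.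
- by apply: ge_sup => //; exists 0.
move=> x Sx; have sup0 : 0 <= sup L by apply: ub_le_sup => //; exists 1.
have sup1 : sup L <= 1 by apply: ge_sup => //; exists 0.
have [Gx|Gx] := ltP (G x) 0.
  have Fx : 0 <= F x by case: (FG x Sx) => // /(lt_le_trans Gx); rewrite ltxx.
  have : l x <= sup L by apply: ub_le_sup; [exists 1|right; exists x].
  by rewrite /l ler_pdivrMr; lra.
have [Fx|Fx] := ltP (F x) 0; last by rewrite addr_ge0 // mulr_ge0 // subr_ge0.
(* Here [F x < 0], and the right-hand side is the upper bound that [x] imposes on [t]. *)
have : sup L <= G x / (G x - F x).
  apply: ge_sup; first by exists 0.
  move=> _ [->|[a [Sa /= Ga] <-]]; first by rewrite divr_ge0 //; lra.
  have Fa : 0 <= F a by case: (FG a Sa) => // /(lt_le_trans Ga); rewrite ltxx.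
  rewrite /l ler_pdivrMr; last lra.
  rewrite mulrAC ler_pdivlMr; last lra.
  by have := cross _ _ Sa Sx Ga Fx; lra.
by rewrite ler_pdivlMr; lra.
Qed.

Lemma convex_alternative m S (F : 'I_m -> E -> R) :
  S !=set0 -> convex_set S -> (forall i, convex_function S (F i)) ->
  (forall x, S x -> exists i, 0 <= F i x) ->
  exists2 theta : 'cV[R]_m, unit_simplex theta &
    forall x, S x -> 0 <= \sum_i theta i 0 * F i x.
Proof.
elim: m S F => [|m IH] S F [x0 Sx0] cS cF alt; first by have [[]] := alt _ Sx0.
pose S' := S `&` [set x | F ord0 x < 0].
have cS' : convex_set S' by exact: convex_sublevel.
have sub : S' `<=` S by move=> x [].
(* If [S'] is empty, the first function is nonnegative on [S] and takes all the weight. *)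
have [/set0P S'0|] := boolP (S' != set0); last first.
  move=> /negPn/eqP S'0; exists (delta_mx ord0 0).
    split=> [i|]; first by rewrite mxE ler0n.
    rewrite (bigD1 ord0) //= mxE !eqxx big1 ?addr0 // => i /negbTE i0.
    by rewrite mxE i0.
  move=> x Sx; rewrite (bigD1 ord0) //= mxE !eqxx mul1r big1 => [|i /negbTE i0].
    by rewrite addr0 leNgt; apply/negP => Fx; have : S' x by []; rewrite S'0.
  by rewrite mxE i0 mul0r.
have [||theta [theta0 theta1] thetaF] := IH S' (F \o lift ord0) S'0 cS'.
- by move=> i; apply: convex_functionS sub _; apply: cF.
- move=> x [Sx Fx]; have [i] := alt x Sx.
  by case: (unliftP ord0 i) => [j ->|->]; [exists j|rewrite leNgt Fx].
have [||x Sx|t [t0 t1 tF]] := @convex_alternative2 S (F ord0)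
  (fun x => \sum_i theta i 0 * F (lift ord0 i) x) cS.
- exact: cF.
- exact: convex_function_sum.
- by have [Fx|Fx] := ltP (F ord0 x) 0; [right; apply: thetaF|left].
(* Weight [t] goes to the first function, and the inductive weights share the remaining [1 - t]. *)
exists (\col_i if unlift ord0 i is Some j then (1 - t) * theta j 0 else t).
  split=> [i|].
    by rewrite mxE; case: unliftP => [j|] _ //; rewrite mulr_ge0 // subr_ge0.
  rewrite big_ord_recl mxE unlift_none.
  under eq_bigr do rewrite mxE liftK.
  by rewrite -mulr_sumr theta1 mulr1 subrKC.
move=> x /tF; rewrite big_ord_recl mxE unlift_none mulr_sumr.
by under [X in _ -> _ <= _ + X]eq_bigr do rewrite mxE liftK -mulrA.
Qed.

End convexity.

(** * Quadratic forms and nearest points in their norms *)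

Section quadratic_forms.
Context {R : realType} {n : nat}.
Implicit Types (A : 'M[R]_n) (x y z : 'cV[R]_n) (C : set 'cV[R]_n)
  (N : 'cV[R]_n -> R).

(** On the diagonal it is convertible to [qform A x], which later rewrites exploit. *)
Definition bform A x y : R := (x^T *m A *m y) 0 0.

Lemma bformC A x y : A^T = A -> bform A x y = bform A y x.
Proof.
by move=> As; rewrite /bform -[in LHS](trmxK (_ *m y)) mxE !trmx_mul trmxK As mulmxA.
Qed.

Lemma qformZD A (a b : R) x y : A^T = A ->
  qform A (a *: x + b *: y) =
    a ^+ 2 * qform A x + 2 * a * b * bform A x y + b ^+ 2 * qform A y.
Proof.
move=> As; have := bformC y x As; rewrite /bform /qform => yx.
rewrite [trmx (_ + _)]linearD /= ![trmx (_ *: _)]linearZ /= !mulmxDl !mulmxDr -!scalemxAl -!scalemxAr.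
have D (M N : 'M[R]_1) : (M + N) 0 0 = M 0 0 + N 0 0 by rewrite mxE.
have Z k (M : 'M[R]_1) : (k *: M) 0 0 = k * M 0 0 by rewrite mxE.
by rewrite !(D, Z) yx; ring.
Qed.

Lemma qformN A x : qform A (- x) = qform A x.
Proof. by rewrite /qform [trmx _]linearN !mulNmx mulmxN opprK. Qed.

Lemma qform0 A : qform A 0 = 0.
Proof. by rewrite /qform mulmx0 mxE. Qed.

Lemma qformB A x y : A^T = A ->
  qform A (x - y) = qform A x - 2 * bform A x y + qform A y.
Proof.
by move=> As; have := qformZD 1 (-1) x y As; rewrite scale1r scaleN1r => ->; ring.
Qed.

(** The exact defect of convexity: it gives both convexity and, at [t = 2^-1], the parallelogram
    identity. *)
Lemma qform_conv A (t : R) x y : A^T = A ->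
  qform A (t *: x + (1 - t) *: y) =
    t * qform A x + (1 - t) * qform A y - t * (1 - t) * qform A (x - y).
Proof. by move=> As; rewrite qformZD // qformB //; ring. Qed.

Lemma qform_midpoint A x y z : A^T = A ->
  qform A (z - (2^-1 *: x + (1 - 2^-1) *: y)) =
    2^-1 * qform A (z - x) + 2^-1 * qform A (z - y) - 4^-1 * qform A (x - y).
Proof.
move=> As; have -> : z - (2^-1 *: x + (1 - 2^-1) *: y) =
    2^-1 *: (z - x) + (1 - 2^-1) *: (z - y).
  by rewrite !scalerBr addrACA -opprD -scalerDl subrKC scale1r.
rewrite qform_conv // (_ : z - x - (z - y) = - (x - y)) ?qformN; first by field.
by rewrite !opprB addrC addrA addrNK.
Qed.

Lemma qform_continuous A : continuous (qform A).
Proof.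
rewrite (_ : qform A = fun x => \sum_j (\sum_i x i 0 * A i j) * x j 0).
  have D : continuous (fun z : R * R => +%R z.1 z.2) by exact: add_continuous.
  have L j : continuous (fun x : 'cV[R]_n => \sum_i x i 0 * A i j).
    apply: (@continuous_big _ _ +%R 0 _ D) => i _ x.
    by apply: continuousM; [exact: coord_continuous|exact: cst_continuous].
  apply: (@continuous_big _ _ +%R 0 _ D) => j _ x.
  by apply: continuousM; [exact: L|exact: coord_continuous].
apply/funext => x; rewrite /qform mxE; apply: eq_bigr => j _; congr (_ * _).
by rewrite mxE; apply: eq_bigr => i _; rewrite mxE.
Qed.

Lemma qform_ge0 A x : sym_posdef A -> 0 <= qform A x.
Proof.
move=> [_ Apos]; have [->|x0] := eqVneq x 0; first by rewrite qform0.
exact/ltW/Apos.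
Qed.

Lemma qform_le0 A x : sym_posdef A -> qform A x <= 0 -> x = 0.
Proof.
by move=> [_ Apos] q0; apply/eqP; apply: contraTT q0 => /Apos; rewrite ltNge.
Qed.

Lemma qform_convex A z : sym_posdef A ->
  convex_function setT (fun x => qform A (x - z)).
Proof.
move=> Apd; have [As _] := Apd; apply/convex_functionP => x y t t0 t1 _ _.
have -> : t *: x + (1 - t) *: y - z = t *: (x - z) + (1 - t) *: (y - z).
  by rewrite !scalerBr addrACA -opprD -scalerDl subrKC scale1r.
rewrite qform_conv // gerDl oppr_le0 mulr_ge0 ?qform_ge0 //.
by rewrite mulr_ge0 // subr_ge0.
Qed.

(** A row of the left kernel, transposed, is a vector on which the form vanishes, so it is zero. *)
Lemma sym_posdef_unit A : sym_posdef A -> A \in unitmx.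
Proof.
move=> Apd; rewrite -row_free_unit -kermx_eq0; apply/eqP/row_matrixP => i.
rewrite row0; apply: trmx_inj; rewrite trmx0; apply: (qform_le0 Apd).
by rewrite /qform trmxK -row_mul mulmx_ker row0 mul0mx mxE.
Qed.

(* Cauchy-Schwarz, as [x i 0] is the [A]-inner product of [x] with
   [invmx A *m delta_mx i 0]. *)
Lemma coord_qform_le A x i : sym_posdef A ->
  x i 0 ^+ 2 <= qform A (invmx A *m delta_mx i 0) * qform A x.
Proof.
move=> Apd; have [As Apos] := Apd; have Au := sym_posdef_unit Apd.
set w := invmx A *m _.
have xE : x i 0 = bform A x w.
  rewrite /bform /w mulmxA mulmxK // mxE (bigD1 i) //= big1.
    by rewrite !mxE !eqxx mulr1 addr0.
  by move=> j /negbTE ji; rewrite !mxE ji mulr0.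
have [w0|w0] := eqVneq w 0.
  by rewrite xE w0 qform0 mul0r /bform mulmx0 mxE expr0n.
(* Up to the factor [qform A w], this vector is the component of [x] that is [A]-orthogonal to
   [w]. *)
have := qform_ge0 (qform A w *: x + - bform A x w *: w) Apd.
rewrite qformZD // -xE; set B := x i 0 => q0; have qw := Apos _ w0.
have : 0 <= qform A w * (qform A w * qform A x - B ^+ 2) by nra.
by rewrite pmulr_rge0 // subr_ge0.
Qed.

(** Lets smallness of the form control all coordinates, so that completeness of the ambient space
    applies. *)
Lemma qform_coord_bound A : sym_posdef A ->
  exists2 K, 0 < K & forall x i, x i 0 ^+ 2 <= K * qform A x.
Proof.
move=> Apd; pose k i := qform A (invmx A *m delta_mx i 0).
have k0 i : 0 <= k i by exact: qform_ge0.
exists (1 + \sum_i k i) => [|x i].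
  by apply: ltr_pwDl => //; apply: sumr_ge0.
apply: le_trans (coord_qform_le x i Apd) _; apply: ler_wpM2r.
  exact: qform_ge0.
rewrite -/(k i) (bigD1 i) //= addrCA lerDl addr_ge0 //; exact: sumr_ge0.
Qed.

(* By the parallelogram identity, the near-minimisers form a Cauchy filter. *)
Lemma qform_nearest_exists A C z : sym_posdef A ->
  closed C -> convex_set C -> C !=set0 ->
  exists2 x, C x & forall y, C y -> qform A (z - x) <= qform A (z - y).
Proof.
move=> Apd Ccl /convex_setP Ccv [c0 Cc0]; have [As _] := Apd.
pose D := [set qform A (z - y) | y in C]; pose d := inf D.
have D0 : lbound D 0 by move=> _ [y _ <-]; exact: qform_ge0.
have dle y : C y -> d <= qform A (z - y).
  by move=> Cy; apply: ge_inf; [exists 0|exists y].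
have hinf : has_inf D by split; [exists (qform A (z - c0)), c0|exists 0].
pose B e := C `&` [set y | qform A (z - y) < d + e].
pose F : set_system 'cV[R]_n := filter_from [set e : R | 0 < e] B.
have FF : ProperFilter F.
  apply: filter_from_proper.
    apply: filter_from_filter; first by exists 1 => /=.
    move=> e1 e2 /= e10 e20; exists (Num.min e1 e2).
      by rewrite /= lt_min e10.
    move=> y [Cy /= qy]; split; split=> //=; apply: lt_le_trans qy _.
      by rewrite lerD2l ge_min lexx.
    by rewrite lerD2l ge_min lexx orbT.
  move=> e /= e0; have [_ [y Cy <-] yd] := inf_adherent e0 hinf.
  by exists y.
(* The midpoint lies in [C], so its value is at least [d]; the parallelogram identity then bounds
   the difference. *)
have diam e y w : B e y -> B e w -> qform A (y - w) <= 4 * e.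
  move=> [Cy /= qy] [Cw /= qw].
  have Cm : C (2^-1 *: y + (1 - 2^-1) *: w) by apply: Ccv => //; lra.
  have := dle _ Cm.
  by rewrite qform_midpoint //; move: (qform A (y - w)) => r; lra.
have [K K0 KP] := qform_coord_bound Apd.
have /cauchy_cvg /cvg_ex [x Fx] : cauchy F.
  (* Chosen so that [K * (4 * e')], which bounds squared coordinate differences, is [e ^+ 2 / 2]. *)
  apply/cauchy_ballP => e e0; pose e' := e ^+ 2 / (8 * K).
  have e'0 : 0 < e' by rewrite divr_gt0 ?exprn_gt0 // mulr_gt0.
  exists (B e', B e'); first by split; exists e'.
  move=> [y w] [/= By Bw]; split=> // i j; rewrite ord1 -ball_normE /=.
  rewrite -(ltr_pXn2r (n := 2)) ?nnegrE ?normr_ge0 ?(ltW e0) // real_normK ?num_real //.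
  have := KP (y - w) i; rewrite !mxE => /le_lt_trans; apply.
  apply: (@le_lt_trans _ _ (K * (4 * e'))).
    by apply: ler_wpM2l (diam _ _ _ By Bw); exact: ltW.
  have -> : K * (4 * e') = e ^+ 2 / 2 by rewrite /e'; field; rewrite gt_eqF.
  by have := exprn_gt0 2 e0; lra.
have Fcl T : closed T -> F T -> T x.
  by move=> clT FT; apply: clT => U /Fx FU; exact: filter_ex (filterI FT FU).
have Fle e : 0 < e -> qform A (z - x) <= d + e.
  move=> e0.
  have cl : closed [set y | qform A (z - y) <= d + e].
    apply: (@preimage_closed _ _ (fun y => qform A (z - y)) [set r | r <= d + e]).
      move=> y _; apply: (@continuous_comp _ _ _ (fun y => z - y) (qform A)).
        by apply: continuousB; [exact: cst_continuous|exact: cvg_id].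
      exact: qform_continuous.
    exact: closed_le.
  apply: Fcl cl _.
  by exists e => // y [_ /=] /ltW.
exists x.
  by apply: Fcl Ccl _; exists 1; [exact: ltr01|move=> y []].
move=> y Cy; apply: le_trans (dle _ Cy).
by apply/ler_addgt0Pr => e /Fle.
Qed.

(** The square root is monotone, so squared distances suffice; uniqueness follows from strict
    convexity. *)
Lemma is_projectionP A C z x : sym_posdef A -> convex_set C ->
  is_projection C (mxnorm A) z x <->
  C x /\ (forall y, C y -> qform A (z - x) <= qform A (z - y)).
Proof.
move=> Apd /convex_setP Ccv; have [As _] := Apd.
have lb : has_lbound [set mxnorm A (z - y) | y in C].
  by exists 0 => _ [y _ <-]; exact: sqrtr_ge0.
split=> [[[Cx xE] _]|[Cx xmin]].
  split=> // y Cy; rewrite -ler_sqrt ?qform_ge0 //.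
  by rewrite -/(mxnorm _ _) xE; apply: ge_inf => //; exists y.
have xE : mxnorm A (z - x) = inf [set mxnorm A (z - y) | y in C].
  apply/eqP; rewrite eq_le; apply/andP; split; last by apply: ge_inf => //; exists x.
  apply: lb_le_inf; first by exists (mxnorm A (z - x)), x.
  by move=> _ [y Cy <-]; rewrite ler_wsqrtr // xmin.
split=> // y [Cy]; rewrite -xE => /eqP.
rewrite eqr_sqrt ?qform_ge0 // => /eqP qE.
(* The midpoint of two distinct minimisers would be strictly nearer to [z]. *)
have Cm : C (2^-1 *: x + (1 - 2^-1) *: y) by apply: Ccv => //; lra.
have := xmin _ Cm.
rewrite qform_midpoint // qE => le; apply/eqP; rewrite -subr_eq0.
apply/eqP/(qform_le0 Apd).
by move: (qform A (x - y)) le => r; lra.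
Qed.

Lemma projection_eq C N z x : is_projection C N z x -> projection C N z = x.
Proof. by move=> xz; apply: xget_unique => // y [yz _]; rewrite (xz.2 y yz). Qed.

End quadratic_forms.

(** * Convexity and closedness of the feasible set *)

Section feasible_set.
Context {R : realType} {n p q : nat}.
Implicit Types (g : 'I_p -> 'cV[R]_n -> R) (h : 'I_q -> 'cV[R]_n -> R).

Lemma feasible_set_convex g h :
  (forall i, convex_function setT (g i)) ->
  (forall j, linear_constraint (h j)) -> convex_set (feasible_set g h).
Proof.
move=> cg lh; apply/convex_setP => x y t t0 t1 [gx hx] [gy hy]; split=> [i|j].
  have /convex_functionP/(_ x y t t0 t1 I I)/le_trans := cg i; apply.
  have := gx i; have := gy i; nra.
have [a [b hE]] := lh j; have := hx j; have := hy j; rewrite !hE.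
rewrite mulmxDr -!scalemxAr.
have -> (u w : 'M[R]_1) : (t *: u + (1 - t) *: w) 0 0 =
    t * u 0 0 + (1 - t) * w 0 0 by rewrite !mxE.
by move=> /(canRL (addrK _))-> /(canRL (addrK _))->; ring.
Qed.

Lemma feasible_set_closed g h :
  (forall i, lower_semicontinuous (fun x => (g i x)%:E)) ->
  (forall j, linear_constraint (h j)) -> closed (feasible_set g h).
Proof.
move=> lscg lh; rewrite (_ : feasible_set g h =
  \bigcap_(i in setT) [set x | g i x <= 0] `&`
  \bigcap_(j in setT) [set x | h j x = 0]); last first.
  apply/seteqP; split=> x [gx hx]; split=> i //=; first exact: gx.
  exact: hx.
apply: closedI; apply: closed_bigI => i _.
  (* Lower semicontinuity amounts to openness of the strict superlevel sets. *)
  rewrite -openC (_ : ~` _ = [set x | (0%:E < (g i x)%:E)%E]).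
    by have /lower_semicontinuousP := lscg i; apply.
  by apply/seteqP; split=> x /=; rewrite lte_fin ltNge => /negP.
have [a [b hE]] := lh i.
apply: (@preimage_closed _ _ (h i) [set r | r = 0]); last exact: closed_eq.
rewrite (_ : h i = fun x => \sum_k a k 0 * x k 0 + b) => [x _|].
  have D : continuous (fun z : R * R => +%R z.1 z.2) by exact: add_continuous.
  apply: continuousD; last exact: cst_continuous.
  move: x; apply: (@continuous_big _ _ +%R 0 _ D) => k _ x.
  by apply: continuousM; [exact: cst_continuous|exact: coord_continuous].
apply/funext => x; rewrite hE mxE; congr (_ + _).
by apply: eq_bigr => k _; rewrite mxE.
Qed.

End feasible_set.

(** * Scalarization by weights in the simplex *)

Section weights.
Context {R : realType} {n m : nat}.
Variables (H : 'I_m -> 'M[R]_n) (c : 'I_m -> 'cV[R]_n) (v : 'I_m -> R).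
Hypothesis H_spd : forall i, sym_posdef (H i).
Implicit Types (theta : 'cV[R]_m) (C : set 'cV[R]_n).

Lemma bform_Htheta theta x y :
  bform (Htheta H theta) x y = \sum_i theta i 0 * bform (H i) x y.
Proof.
rewrite /bform /Htheta mulmx_sumr mulmx_suml summxE; apply: eq_bigr => i _.
by rewrite -scalemxAr -scalemxAl mxE.
Qed.

(** If the weighted sum of positive values vanished, all weights would be 0, although they sum to
    1. *)
Lemma sym_posdef_Htheta theta :
  unit_simplex theta -> sym_posdef (Htheta H theta).
Proof.
move=> [theta0 theta1]; split=> [|x x0].
  by rewrite linear_sum; apply: eq_bigr => i _; rewrite linearZ /= (H_spd i).1.
rewrite -[qform _ _]/(bform _ _ _) bform_Htheta.
have pos i : 0 < bform (H i) x x by exact: (H_spd i).2.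
have sum0 (P : pred 'I_m) : 0 <= \sum_(i | P i) theta i 0 * bform (H i) x x.
  by apply: sumr_ge0 => i _; rewrite mulr_ge0 // ltW.
rewrite lt_neqAle sum0 andbT eq_sym; apply/eqP => /psumr_eq0P S0.
have: 0 = 1 :> R; last by move/eqP; rewrite eq_sym oner_eq0.
rewrite -theta1 big1 // => i _.
have /eqP := S0 (fun j _ => mulr_ge0 (theta0 j) (ltW (pos j))) i isT.
by rewrite mulf_eq0 (gt_eqF (pos i)) orbF => /eqP.
Qed.

(** Completing the square: [ctheta] is defined so that the cross terms agree, which is [Tz]
    below. *)
Lemma weighted_quadratic theta : unit_simplex theta -> exists K, forall x,
  \sum_i theta i 0 * quadratic (H i) (c i) (v i) x =
    2^-1 * qform (Htheta H theta) (x - ctheta H c theta) + K.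
Proof.
move=> /sym_posdef_Htheta Tpd; have [Ts _] := Tpd.
set T := Htheta H theta in Tpd Ts *; set z := ctheta H c theta.
have Tz x : bform T x z = \sum_i theta i 0 * bform (H i) x (c i).
  rewrite /bform mulmxA mulmxK ?sym_posdef_unit // mulmx_sumr summxE.
  by apply: eq_bigr => i _; rewrite -scalemxAr mxE mulmxA.
exists (\sum_i theta i 0 * (2^-1 * qform (H i) (c i) + v i)
        - 2^-1 * qform T z) => x.
rewrite qformB // Tz -[qform T x]/(bform T x x) bform_Htheta.
transitivity (2^-1 * (\sum_i theta i 0 * bform (H i) x x)
  - \sum_i theta i 0 * bform (H i) x (c i)
  + \sum_i theta i 0 * (2^-1 * qform (H i) (c i) + v i)); last by field.
rewrite mulr_sumr -sumrB -big_split /=; apply: eq_bigr => i _.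
by rewrite /quadratic qformB ?(H_spd i).1 // -[qform _ x]/(bform _ x x); field.
Qed.

(** Stated for a general convex set so as to serve both the feasible set and the whole space. *)
Lemma pareto_projectionP C x : (0 < m)%N -> convex_set C ->
  let f := fun x => \col_i quadratic (H i) (c i) (v i) x in
  pareto_set f C x <->
  exists2 theta, unit_simplex theta &
    is_projection C (mxnorm (Htheta H theta)) (ctheta H c theta) x.
Proof.
move=> m_gt0 Ccv f; split=> [[Cx xopt]|[theta thetaS]].
  pose F i y := quadratic (H i) (c i) (v i) y - quadratic (H i) (c i) (v i) x.
  have cF i : convex_function C (F i).
    apply: (@convex_functionS _ _ _ setT) => //.
    apply/convex_functionP => y w t t0 t1 _ _; rewrite /F /quadratic.
    have /convex_functionP/(_ y w t t0 t1 I I) := qform_convex (c i) (H_spd i).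
    by move: (qform _ (_ + _ - _)) => r; lra.
  have [||theta thetaS thetaF] := @convex_alternative _ _ m C F _ Ccv cF.
  - by exists x.
  (* If every [F i y] were negative, [y] would dominate [x]; [m_gt0] supplies the strict index. *)
  - move=> y Cy; apply: contrapT => /forallNP Fy; apply: xopt; exists y => //.
    have lt i : f y i 0 < f x i 0.
      by have /negP := Fy i; rewrite -ltNge !mxE subr_lt0.
    by split=> [i|]; [exact: ltW|exists (Ordinal m_gt0)].
  exists theta => //; have Tpd := sym_posdef_Htheta thetaS.
  apply/is_projectionP => //; split=> // y /thetaF.
  have [K KE] := weighted_quadratic thetaS.
  under eq_bigr do rewrite mulrBr.
  rewrite sumrB !KE -!(qformN _ (_ - ctheta _ _ _)) !opprB.
  by lra.
have Tpd := sym_posdef_Htheta thetaS.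
move=> xproj; have /is_projectionP [//|//|Cx xmin] := xproj.
split=> // -[y Cy [yx [j yxj]]].
have [K KE] := weighted_quadratic thetaS.
(* The objective that improves strictly may have weight 0, so domination only makes [y] another
   nearest point; uniqueness of the projection then gives equality. *)
have xy : x = y.
  apply: xproj.2; split=> //; rewrite -xproj.1.2; congr Num.sqrt; apply/eqP.
  rewrite eq_le xmin // andbT -!(qformN _ (ctheta _ _ _ - _)) !opprB.
  have : \sum_i theta i 0 * quadratic (H i) (c i) (v i) y <=
         \sum_i theta i 0 * quadratic (H i) (c i) (v i) x.
    apply: ler_sum => i _; apply: ler_wpM2l; first exact: thetaS.1.
    by have := yx i; rewrite !mxE.
  by rewrite !KE; lra.
by move: yxj; rewrite xy ltxx.
Qed.

End weights.

Theorem theorem3p5 (R : realType) (n m p q : nat)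
    (hn : (0 < n)%N) (hm : (0 < m)%N)
    (H : 'I_m -> 'M[R]_n) (c : 'I_m -> 'cV[R]_n) (v : 'I_m -> R)
    (c_inj : forall i j, i != j -> c i != c j)
    (H_spd : forall i, sym_posdef (H i))
    (f : 'cV[R]_n -> 'cV[R]_m)
    (fE : f = fun x => \col_i quadratic (H i) (c i) (v i) x)
    (g : 'I_p -> 'cV[R]_n -> R)
    (g_convex : forall i, convex_function setT (g i))
    (g_lsc : forall i, lower_semicontinuous (fun x => (g i x)%:E))
    (h : 'I_q -> 'cV[R]_n -> R)
    (h_linear : forall j, linear_constraint (h j))
    (C : set 'cV[R]_n) (CE : C = feasible_set g h)
    (C_nonempty : C !=set0) :
  [/\ (forall theta, unit_simplex theta ->
         pareto_set f setT (ctheta H c theta)),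
      (forall x, pareto_set f C x <->
         exists2 theta, unit_simplex theta &
           is_projection C (mxnorm (Htheta H theta)) (ctheta H c theta) x)
    & pareto_set f C =
        [set projection C (mxnorm (Htheta H theta)) (ctheta H c theta)
        | theta in unit_simplex] ].
Proof.
have Ccv : convex_set C by rewrite CE; exact: feasible_set_convex.
have Ccl : closed C by rewrite CE; exact: feasible_set_closed.
have Tcv : convex_set [set: 'cV[R]_n] by apply/convex_setP.
have paretoP x : pareto_set f C x <-> exists2 theta, unit_simplex theta &
    is_projection C (mxnorm (Htheta H theta)) (ctheta H c theta) x.
  by rewrite fE; exact: pareto_projectionP.
split=> //.
  move=> theta thetaS; have Tpd := sym_posdef_Htheta H_spd thetaS.
  rewrite fE; apply/pareto_projectionP => //; exists theta => //.
  (* Over the whole space, [ctheta H c theta] is its own projection. *)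
  by apply/is_projectionP => //; split=> // y _; rewrite subrr qform0 qform_ge0.
apply/seteqP; split=> x.
  by move=> /paretoP [theta thetaS /projection_eq xE]; exists theta.
move=> [theta thetaS <-]; apply/paretoP; exists theta => //.
have Tpd := sym_posdef_Htheta H_spd thetaS.
(* A nearest point exists, so [projection] does not fall back on its default value 0. *)
have [y Cy ymin] := qform_nearest_exists (ctheta H c theta) Tpd Ccl Ccv C_nonempty.
have yproj : is_projection C (mxnorm (Htheta H theta)) (ctheta H c theta) y.
  exact/is_projectionP.
by rewrite (projection_eq yproj).
Qed.
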